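(* Let $q=p^k$ with $p$ prime and $k\ge1$. The number of equivalence classes, under dynamical equivalence, of the dynamical systems $(\mathbb{F}_q,x\mapsto f(x))$ with $f(X)=aX^p+b$, $a\in\mathbb{F}_q^*$, $b\in\mathbb{F}_q$, is equal to $\tau(p-1)+1$, where $\tau(m)$ is the number of positive divisors of $m$. In particular, exactly one of these equivalence classes consists of systems having no fixed point. Moreover, if such an $f=aX^p+b$ has a fixed point, then it has exactly $p$ fixed points if $\mathrm{Nm}_{\mathbb{F}_q/\mathbb{F}_p}(a)=1$, and otherwise it has exactly one fixed point.
   Context: Two dynamical systems $(\mathbb{S},f)$ and $(\mathbb{T},g)$ (maps $f:\mathbb{S}\to\mathbb{S}$, $g:\mathbb{T}\to\mathbb{T}$) are dynamically equivalent if there is a bijection $\sigma:\mathbb{S}\to\mathbb{T}$ with $\sigma^{-1}\circ g\circ\sigma=f$. A fixed point of $f$ is $x\in\mathbb{F}_q$ with $f(x)=x$. The norm is $\mathrm{Nm}_{\mathbb{F}_q/\mathbb{F}_p}(x)=x^{1+p+\cdots+p^{k-1}}$. *)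

(* Defs.v *)
From HB Require Import structures.
From mathcomp Require Import all_boot all_order all_algebra all_fingroup all_field.

Set Implicit Arguments.
Unset Strict Implicit.
Unset Printing Implicit Defensive.

Import GRing.Theory.
Local Open Scope ring_scope.

Definition dyn_equiv (S T : Type) (f : S -> S) (g : T -> T) : Prop :=
  exists (s : S -> T) (t : T -> S),
    [/\ cancel s t, cancel t s & forall x, t (g (s x)) = f x].

(* On finite types dynamical equivalence is decidable; the boolean version is
   what [equivalence_partition] needs. *)
Definition dyn_equivb (S T : finType) (f : S -> S) (g : T -> T) : bool :=
  [exists s : {ffun S -> T}, [exists t : {ffun T -> S},
    [&& [forall x, t (s x) == x], [forall y, s (t y) == y]
      & [forall x, t (g (s x)) == f x]]]].

Lemma dyn_equivP (S T : finType) (f : S -> S) (g : T -> T) :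
  reflect (dyn_equiv f g) (dyn_equivb f g).
Proof.
apply: (iffP existsP) => [[s /existsP[t /and3P[st ts fg]]]|[s [t [st ts fg]]]].
  by exists s, t; split=> x; apply/eqP; [apply: (forallP st) |
    apply: (forallP ts) | apply: (forallP fg)].
exists (finfun s); apply/existsP; exists (finfun t).
by apply/and3P; split; apply/forallP=> x; rewrite !ffunE ?st ?ts ?fg.
Qed.

Lemma dyn_equiv_refl (S : Type) (f : S -> S) : dyn_equiv f f.
Proof. by exists id, id. Qed.

Lemma dyn_equiv_sym (S T : Type) (f : S -> S) (g : T -> T) :
  dyn_equiv f g -> dyn_equiv g f.
Proof.
by case=> s [t [st ts fg]]; exists t, s; split=> // y; rewrite -fg !ts.
Qed.

Lemma dyn_equiv_trans (S T U : Type) (f : S -> S) (g : T -> T) (h : U -> U) :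
  dyn_equiv f g -> dyn_equiv g h -> dyn_equiv f h.
Proof.
case=> s [t [st ts fg]] [s' [t' [st' ts' gh]]].
exists (s' \o s), (t \o t'); split=> x /=; by rewrite ?st' ?st ?ts ?ts' ?gh.
Qed.

Definition fixed_points (T : finType) (f : T -> T) : {set T} :=
  [set x | f x == x].

Definition frob_poly (F : finFieldType) (p : nat) (a b : F) : {poly F} :=
  a *: 'X^p + b%:P.

Definition frob_map (F : finFieldType) (p : nat) (a b : F) : {ffun F -> F} :=
  [ffun x => (frob_poly p a b).[x]].

Definition frob_systems (F : finFieldType) (p : nat) : {set {ffun F -> F}} :=
  [set frob_map p ab.1 ab.2 | ab : F * F & ab.1 != 0].

Definition frob_classes (F : finFieldType) (p : nat) :
    {set {set {ffun F -> F}}} :=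
  equivalence_partition
    (fun f g : {ffun F -> F} => dyn_equivb f g) (frob_systems F p).

(* The norm to the prime field, with value kept in F, when #|F| = p ^ k. *)
Definition norm_Fp (F : finFieldType) (p k : nat) (x : F) : F :=
  x ^+ (\sum_(i < k) p ^ i)%N.

Definition tau (m : nat) : nat := size (divisors m).

(* Main.v *)
(* A system a X^p + b with a fixed point is conjugate, by a translation, to the
   additive map L_a = a X^p.  Fix a generator g of F^*.  Conjugating by scalings
   multiplies a by (p-1)-th powers, and conjugating by x |-> x^m, with m prime to
   q - 1, turns L_a into L_(a^m); so every L_a is conjugate to L_(g^d) for some
   d | p - 1.  These are pairwise inequivalent: the k-th iterate of L_a is
   multiplication by Nm(a), so the order of Nm(a), which is (p-1)/d for a = g^d,
   is a conjugacy invariant.  If a X^p + b has no fixed point, X - a X^p is not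
   onto, hence has a nonzero root, and a scaling reduces to a = 1; as the image
   of X^p - X has index p, all fixed-point-free X^p + b are conjugate through
   scalings by F_p^* and translations. *)
Require Import Defs.
From HB Require Import structures.
From mathcomp Require Import all_boot all_order all_algebra all_fingroup all_field.
From mathcomp Require Import ring.

Set Implicit Arguments.
Unset Strict Implicit.
Unset Printing Implicit Defensive.

Import GRing.Theory.
Local Open Scope ring_scope.

(** * Conjugacy invariants and counting of classes *)

Lemma dyn_equiv_intertwine (T : finType) (f g s : T -> T) :
  injective s -> (forall x, g (s x) = s (f x)) -> dyn_equiv f g.
Proof.
move=> s_inj gs; exists s, (invF s_inj); split; first exact: invF_f.
- exact: f_invF.
- by move=> x; rewrite gs invF_f.
Qed.

(** Which iterates are the identity is the conjugacy invariant that later separates the linear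
    systems. *)
Lemma dyn_equiv_iter_id (S T : Type) (f : S -> S) (g : T -> T) (n : nat) :
  dyn_equiv f g -> (forall x, iter n f x = x) -> forall y, iter n g y = y.
Proof.
case=> s [t [st ts fg]] fn y.
have sf x : s (f x) = g (s x) by rewrite -fg ts.
have sfn m x : s (iter m f x) = iter m g (s x).
  by elim: m => //= m IH; rewrite sf IH.
by rewrite -[y]ts -sfn fn.
Qed.

Lemma dyn_equiv_fixed_point (S T : Type) (f : S -> S) (g : T -> T) :
  dyn_equiv f g -> (exists x, f x = x) -> exists y, g y = y.
Proof. by case=> s [t [st ts fg]] [x fx]; exists (s x); rewrite -[LHS]ts fg fx. Qed.

Lemma dyn_equivb_equivalence (T : finType) :
  equivalence_rel (fun f g : {ffun T -> T} => dyn_equivb f g).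
Proof.
move=> f g h; split; first by apply/dyn_equivP/dyn_equiv_refl.
move=> /dyn_equivP fg; apply/dyn_equivP/dyn_equivP => [fh|gh].
  exact: dyn_equiv_trans (dyn_equiv_sym fg) fh.
exact: dyn_equiv_trans fg gh.
Qed.

(** Sending a representative in [rs] to its class is onto by the covering hypothesis, and injective
    because inequivalent elements have different classes. *)
Lemma card_equivalence_partition (T : finType) (R : rel T) (D : {set T})
    (rs : seq T) :
    equivalence_rel R -> uniq rs -> {subset rs <= D} ->
    {in rs &, forall x y, R x y -> x = y} ->
    {in D, forall x, exists2 y, y \in rs & R x y} ->
  #|equivalence_partition R D| = size rs.
Proof.
move=> eqR rs_uniq rsD rs_inj rs_cov.
have Rxx x : R x x by case: (eqR x x x).
have Rl x y : R x y -> R x =1 R y by move=> Rxy z; case: (eqR x y z) => _ ->.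
have -> : equivalence_partition R D = [set [set y in D | R x y] | x in rs].
  apply/setP=> C; apply/imsetP/imsetP => -[x xD ->]; last by exists x; rewrite ?rsD.
  have [y yrs Rxy] := rs_cov x xD; exists y => //.
  by apply/setP=> z; rewrite !inE (Rl x y).
rewrite card_in_imset ?(card_uniqP rs_uniq) // => x y xrs yrs /setP/(_ y).
by rewrite !inE rsD // Rxx => /rs_inj ->.
Qed.

(** * An arithmetic lemma and the cyclic group of a finite field *)

(* The added factor [t] meets exactly the primes of [m] that miss [i], and those
   dividing [i] already miss [n]. *)
Lemma coprime_shift (i n m : nat) : (0 < m)%N -> (0 < i)%N -> coprime i n ->
  exists t, coprime (i + n * t) m.
Proof.
move=> m0 i0 cin; pose t := (m`_(\pi(i)^'))%N; exists t.
rewrite coprime_sym coprime_has_primes ?addn_gt0 ?i0 //.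
apply/hasPn=> r /=; rewrite !mem_primes => /and3P[r_pr _ r_dvd].
apply/negP=> /and3P[_ _ rm].
have [ri|ri] := boolP (r %| i)%N.
  have : (r %| n * t)%N by rewrite -(dvdn_addr _ ri).
  rewrite Euclid_dvdM // => /orP[rn|rt].
    have : (r %| gcdn i n)%N by rewrite dvdn_gcd ri.
    by rewrite (eqP cin) Euclid_dvd1.
  have : r \in primes t by rewrite mem_primes r_pr part_gt0.
  by rewrite primes_part mem_filter !inE mem_primes r_pr i0 ri.
have rt : (r %| t)%N.
  have : r \in primes t.
    by rewrite primes_part mem_filter !inE !mem_primes r_pr i0 m0 rm (negPf ri).
  by rewrite mem_primes => /and3P[].
by move: r_dvd; rewrite dvdn_addl ?dvdn_mull // (negPf ri).
Qed.

Lemma expf_card_pred (F : finFieldType) (x : F) : x != 0 -> x ^+ #|F|.-1 = 1.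
Proof.
move=> x0; apply: (mulfI x0).
by rewrite -exprS prednK ?(ltn_trans _ (finNzRing_gt1 F)) // expf_card mulr1.
Qed.

(** The nonzero elements are [#|F|.-1] distinct roots of unity of that order, as many as a field can
    hold, which forces a primitive one. *)
Lemma finField_prim_root (F : finFieldType) :
  exists g : F, (#|F|.-1).-primitive_root g.
Proof.
pose rs := [seq x <- enum F | x != 0].
have F1 := finNzRing_gt1 F.
have : has (#|F|.-1).-primitive_root rs.
  apply: cyclic.has_prim_root.
  - by rewrite -ltnS prednK // (ltn_trans _ F1).
  - apply/allP=> x; rewrite mem_filter => /andP[x0 _].
    by rewrite unity_rootE expf_card_pred.
  - by rewrite filter_uniq ?enum_uniq.
  - rewrite size_filter -(cardC1 (0 : F)) cardE size_filter.
    by rewrite leq_eqVlt; apply/orP; left; apply/eqP; rewrite -enumT.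
by case/hasP=> g _; exists g.
Qed.

(** * Iterates and elementary conjugations of a X^p + b *)

Lemma frob_mapE (F : finFieldType) (p : nat) (a b x : F) :
  frob_map p a b x = a * x ^+ p + b.
Proof. by rewrite ffunE /frob_poly !hornerE. Qed.

Lemma iter_frob_map0 (F : finFieldType) (p : nat) (a x : F) (j : nat) :
  iter j (frob_map p a 0) x = a ^+ (\sum_(i < j) p ^ i) * x ^+ (p ^ j).
Proof.
elim: j => [|j IH]; first by rewrite big_ord0 mul1r.
rewrite iterS IH frob_mapE addr0 exprMn -!exprM -expnSr mulrA -exprS.
rewrite big_ord_recl expn0 add1n mulnC big_distrr /=.
by congr (_ ^+ _.+1 * _); apply: eq_bigr => i _; rewrite -expnS.
Qed.

(** Since x^(p^k) = x, the k-th iterate of a X^p is multiplication by the norm of a; the power m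
    serves to read off the order of that norm. *)
Lemma iter_frob_map0_norm (F : finFieldType) (p k m : nat) (a x : F) :
  #|F| = (p ^ k)%N -> iter (m * k) (frob_map p a 0) x = norm_Fp p k a ^+ m * x.
Proof.
move=> cF; elim: m x => [|m IH] x; first by rewrite mul1r.
by rewrite mulSn iterD IH iter_frob_map0 -cF expf_card exprS -mulrA.
Qed.

(* The conjugating map is x |-> c x. *)
Lemma dyn_equiv_frob_scale (F : finFieldType) (p : nat) (a b c : F) :
  (0 < p)%N -> c != 0 ->
  dyn_equiv (frob_map p (a * c ^+ p.-1) b) (frob_map p a (c * b)).
Proof.
move=> p0 c0; apply: (@dyn_equiv_intertwine _ _ _ ( *%R c)); first exact: mulfI.
move=> x; rewrite !frob_mapE mulrDr -[in LHS](prednK p0) exprMn exprS.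
by rewrite prednK // !mulrA [c * a]mulrC.
Qed.

(* The conjugating map is x |-> x^m, a bijection of F since m is prime to #|F| - 1. *)
Lemma dyn_equiv_frob_power (F : finFieldType) (p m : nat) (a : F) :
  (0 < m)%N -> (0 < p)%N -> coprime m #|F|.-1 ->
  dyn_equiv (frob_map p a 0) (frob_map p (a ^+ m) 0).
Proof.
move=> m0 p0 cm; apply: (@dyn_equiv_intertwine _ _ _ (fun x : F => x ^+ m)).
  case: (egcdnP #|F|.-1 m0) => u v; rewrite (eqP cm) => uv _.
  apply: (@can_inj _ _ _ (fun x => x ^+ u)) => x.
  rewrite -exprM mulnC uv addn1 exprS mulnC exprM.
  have [->|x0] := eqVneq x 0; first by rewrite mul0r.
  by rewrite expf_card_pred // expr1n mulr1.
by move=> x; rewrite !frob_mapE !addr0 exprMn -!exprM mulnC.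
Qed.

Lemma exprBp_pchar (R : comNzRingType) (p : nat) (x y : R) :
  p \in [pchar R] -> (x - y) ^+ p = x ^+ p - y ^+ p.
Proof.
move=> cp; have := pFrobenius_autB_comm cp (mulrC x y).
by rewrite !pFrobenius_autE.
Qed.

Lemma exprDp_pchar (R : comNzRingType) (p : nat) (x y : R) :
  p \in [pchar R] -> (x + y) ^+ p = x ^+ p + y ^+ p.
Proof.
move=> cp; have := pFrobenius_autD_comm cp (mulrC x y).
by rewrite !pFrobenius_autE.
Qed.

(* The conjugating map is x |-> x + c. *)
Lemma dyn_equiv_frob_translate (F : finFieldType) (p : nat) (a b c : F) :
  p \in [pchar F] ->
  dyn_equiv (frob_map p a (a * c ^+ p + b - c)) (frob_map p a b).
Proof.
move=> cp; apply: (@dyn_equiv_intertwine _ _ _ (+%R^~ c)); first exact: addIr.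
by move=> x; rewrite !frob_mapE exprDp_pchar // mulrDr !addrA subrK.
Qed.

(** * The norm and powers of a generator *)

Lemma pred_card_norm (F : finFieldType) (p k : nat) :
  #|F| = (p ^ k)%N -> #|F|.-1 = (p.-1 * \sum_(i < k) p ^ i)%N.
Proof. by move=> ->; exact: predn_exp. Qed.

Lemma sum_pow_gt0 (F : finFieldType) (p k : nat) :
  #|F| = (p ^ k)%N -> (0 < \sum_(i < k) p ^ i)%N.
Proof.
move=> /pred_card_norm e; rewrite lt0n; apply/negP=> /eqP e0.
by have := finNzRing_gt1 F; rewrite -subn_gt0 subn1 e e0 muln0.
Qed.

(** The group order is (p-1)S with S the norm exponent, so cancelling S leaves divisibility by
    p-1. *)
Lemma prim_root_norm_pow (F : finFieldType) (p k i m : nat) (g : F) :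
  #|F| = (p ^ k)%N -> (#|F|.-1).-primitive_root g ->
  (norm_Fp p k (g ^+ i) ^+ m == 1) = (p.-1 %| i * m)%N.
Proof.
move=> cF gP; rewrite /norm_Fp exprAC -!exprM -(prim_order_dvd gP).
by rewrite (pred_card_norm cF) mulnA dvdn_pmul2r // (sum_pow_gt0 cF).
Qed.

Lemma prim_root_log (F : finFieldType) (g a : F) :
  (#|F|.-1).-primitive_root g -> a != 0 -> exists i : nat, a = g ^+ i.
Proof.
by move=> gP /expf_card_pred a1; have [i ->] := prim_rootP gP a1; exists i.
Qed.

Lemma prim_root_neq0 (R : idomainType) (n : nat) (g : R) :
  n.-primitive_root g -> g != 0.
Proof.
move=> gP; apply/eqP=> g0; have /eqP := prim_expr_order gP.
by rewrite g0 expr0n eqn0Ngt (prim_order_gt0 gP) eq_sym oner_eq0.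
Qed.

(** This is Hilbert 90 for F over its prime field: for a = g^i, trivial norm forces p-1 to divide
    i. *)
Lemma norm_Fp_eq1 (F : finFieldType) (p k : nat) (a : F) :
  #|F| = (p ^ k)%N -> a != 0 -> norm_Fp p k a = 1 ->
  exists2 c : F, c != 0 & a = c ^+ p.-1.
Proof.
move=> cF a0 Na; have [g gP] := finField_prim_root F.
have [i ai] := prim_root_log gP a0.
have := prim_root_norm_pow i 1 cF gP; rewrite -ai expr1 Na eqxx muln1.
move=> /esym/dvdnP[j ij]; exists (g ^+ j); last by rewrite ai ij exprM.
by rewrite expf_neq0 // (prim_root_neq0 gP).
Qed.

(** The k-th iterate of a X^p fixes z and also multiplies it by the norm of a. *)
Lemma norm_Fp_fixed (F : finFieldType) (p k : nat) (a z : F) :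
  #|F| = (p ^ k)%N -> z != 0 -> a * z ^+ p = z -> norm_Fp p k a = 1.
Proof.
move=> cF z0 az; apply: (mulIf z0).
rewrite -[norm_Fp _ _ _]expr1 -iter_frob_map0_norm // mul1n mul1r.
by elim: k {cF} => //= k ->; rewrite frob_mapE addr0.
Qed.

(** * Counting fixed points *)

Lemma card_prime_subfield (F : finFieldType) (p : nat) :
  p \in [pchar F] -> #|[set x : F | x ^+ p == x]| = p.
Proof.
move=> cp; have p_pr := pcharf_prime cp.
have p1 := prime_gt1 p_pr.
apply/eqP; rewrite eqn_leq; apply/andP; split.
  have sz : size ('X^p - 'X : {poly F}) = p.+1.
    by rewrite size_polyDl ?size_polyXn // size_polyN size_polyX.
  rewrite -ltnS -sz cardE; apply: max_poly_roots; last exact: enum_uniq.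
    by rewrite -size_poly_eq0 sz.
  apply/allP=> x; rewrite mem_enum inE => /eqP xp.
  by rewrite rootE !hornerE xp subrr.
have inj : injective (fun i : 'I_p => (i%:R : F)).
  move=> i j; wlog ij : i j / (i <= j)%N.
    by move=> H; case: (leqP i j) => [/H|/ltnW/H h /esym/h].
  move=> /esym/eqP; rewrite -subr_eq0 -natrB // -(dvdn_pcharf cp) => d.
  apply/val_inj/eqP; rewrite eqn_leq ij /= -subn_eq0.
  rewrite -leqn0 leqNgt; apply/negP => /dvdn_leq/(_ d).
  by rewrite leqNgt (leq_ltn_trans (leq_subr _ _) (ltn_ord j)).
rewrite -[X in (X <= _)%N]card_ord -(card_imset _ inj); apply/subset_leq_card.
apply/subsetP=> _ /imsetP[i _ ->].
by rewrite inE -(pFrobenius_autE cp) pFrobenius_aut_nat.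
Qed.

(** With c a fixed point and a = d^(p-1), the substitution y -> (y-c)d carries the fixed points to
    the solutions of x^p = x, that is, to the prime field. *)
Lemma card_fixed_norm1 (F : finFieldType) (p k : nat) (a b : F) :
  prime p -> #|F| = (p ^ k)%N -> a != 0 -> (exists x, frob_map p a b x = x) ->
  norm_Fp p k a = 1 -> #|fixed_points (frob_map p a b)| = p.
Proof.
move=> p_pr cF a0 [c fc] /(norm_Fp_eq1 cF a0)[d d0 ad].
have cp := card_finPcharP cF p_pr.
have p0 := prime_gt0 p_pr.
pose s (x : F) : F := (x - c) * d.
have sK (y : F) : (y \in fixed_points (frob_map p a b)) = (s y ^+ p == s y).
  rewrite inE frob_mapE /s.
  move: fc; rewrite frob_mapE => /(canRL (addKr _)) ->.
  have -> : ((y - c) * d) ^+ p = a * (y - c) ^+ p * d.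
    by rewrite exprMn -[in d ^+ p](prednK p0) exprSr -ad mulrA [_ * a]mulrC.
  rewrite (inj_eq (mulIf d0)) -subr_eq0 -[RHS]subr_eq0 exprBp_pchar //.
  by congr (_ == 0); ring.
rewrite -[RHS](card_prime_subfield cp) -[RHS](on_card_preimset (f := s)).
  by apply: eq_card => y; rewrite sK !inE.
by exists (fun x => x / d + c) => x _; rewrite /s ?addrK ?divfK // mulfK // subrK.
Qed.

(** The difference of two fixed points is fixed by a X^p, and a nonzero one would force norm 1. *)
Lemma card_fixed_norm_neq1 (F : finFieldType) (p k : nat) (a b : F) :
  prime p -> #|F| = (p ^ k)%N -> (exists x, frob_map p a b x = x) ->
  norm_Fp p k a <> 1 -> #|fixed_points (frob_map p a b)| = 1%N.
Proof.
move=> p_pr cF [c fc] Na; have cp := card_finPcharP cF p_pr.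
apply/eqP/cards1P; exists c; apply/setP=> y; rewrite !inE.
apply/eqP/eqP=> [fy|-> //]; apply/eqP; rewrite -subr_eq0.
apply/negPn/negP=> yc; case: Na; apply: (norm_Fp_fixed cF yc).
move: fy fc; rewrite exprBp_pchar // !frob_mapE => fy fc.
have -> : y - c = (a * y ^+ p + b) - (a * c ^+ p + b) by rewrite fy fc.
by ring.
Qed.

(** * The image of X^p - X *)

(** The fibre through z consists of the fixed points of X^p + (z - z^p), and the norm of 1 is 1, so
    each fibre has p elements. *)
Lemma card_artin_schreier (F : finFieldType) (p k : nat) :
  prime p -> #|F| = (p ^ k)%N -> (#|[set (x ^+ p - x)%R | x : F]| * p)%N = #|F|.
Proof.
move=> p_pr cF; rewrite -[RHS]sum1_card.
rewrite (partition_big_imset (fun x : F => x ^+ p - x)) /=.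
rewrite -sum_nat_const; apply: eq_bigr => _ /imsetP[z _ ->].
rewrite sum1_card; have N1 : norm_Fp p k (1 : F) = 1 by rewrite /norm_Fp expr1n.
have fixE (x : F) :
    (x \in fixed_points (frob_map p 1 (z - z ^+ p))) = (x ^+ p - x == z ^+ p - z).
  rewrite inE frob_mapE mul1r -subr_eq0 -[RHS]subr_eq0.
  by congr (_ == 0); ring.
rewrite -(eq_card fixE) (card_fixed_norm1 p_pr cF (oner_neq0 F) _ N1) //.
by exists z; rewrite frob_mapE mul1r addrC subrK.
Qed.

(* The image of x |-> x^p - x has index p, so the F_p-line of any b0 outside it
   meets every coset. *)
Lemma artin_schreier_decomp (F : finFieldType) (p k : nat) (b0 b : F) :
    prime p -> #|F| = (p ^ k)%N -> b0 \notin [set x ^+ p - x | x : F] ->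
  exists c y : F, c ^+ p = c /\ b = y ^+ p - y + c * b0.
Proof.
move=> p_pr cF; set I := [set _ | x : F] => b0I.
have cp := card_finPcharP cF p_pr.
pose K := [set x : F | x ^+ p == x].
pose s (cy : F * F) := cy.2 + cy.1 * b0.
have s_inj : {in setX K I &, injective s}.
  move=> [c y] [c' y'] /setXP[cK /imsetP[u _ yu]] /setXP[c'K /imsetP[v _ yv]].
  rewrite /s /= => e; have cc : c = c'.
    (* If c and c' differ, then (v-u)/(c-c') is a preimage of [b0] under X^p - X, because c-c'
       equals its own p-th power. *)
    apply/eqP; rewrite -subr_eq0; apply/negPn/negP=> d0; case/negP: b0I.
    apply/imsetP; exists ((v - u) / (c - c')) => //.
    move: cK c'K; rewrite !inE => /eqP cK /eqP c'K.
    rewrite exprMn exprVn !exprBp_pchar // cK c'K -mulrBl; apply/(mulIf d0).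
    rewrite divfK // -[RHS]/(v ^+ p - u ^+ p - (v - u)).
    have -> : b0 * (c - c') = (y + c * b0) - (y' + c' * b0) + (y' - y) by ring.
    by rewrite e subrr add0r yu yv; ring.
  by move: e; rewrite cc => /addIr ->.
have : s @: setX K I = setT.
  (* The domain has p|I| = |F| elements, so injectivity gives surjectivity. *)
  apply/eqP; rewrite eqEcard subsetT cardsT card_in_imset // cardsX.
  by rewrite (card_prime_subfield cp) mulnC (card_artin_schreier p_pr cF) leqnn.
move=> /setP/(_ b); rewrite inE => /imsetP[[c y] /setXP[]].
rewrite inE => /eqP cK /imsetP[u _ yu] ->.
by exists c, u; rewrite /s /= yu.
Qed.

Lemma artin_schreier_not_surjective (F : finFieldType) (p k : nat) :
    prime p -> #|F| = (p ^ k)%N ->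
  exists b : F, b \notin [set x ^+ p - x | x : F].
Proof.
move=> p_pr cF; apply/existsP; rewrite -negb_forall; apply/negP=> /forallP H.
have := card_artin_schreier p_pr cF.
have -> : [set x ^+ p - x | x : F] = setT by apply/setP=> x; rewrite H inE.
rewrite cardsT => /eqP; rewrite -[X in _ == X]muln1 eqn_pmul2l.
  by rewrite gtn_eqF ?prime_gt1.
by rewrite (ltn_trans _ (finNzRing_gt1 F)).
Qed.

Lemma artin_schreier_fixed_point (F : finFieldType) (p : nat) (b : F) :
  p \in [pchar F] -> (exists x, frob_map p 1 b x = x) <->
  b \in [set x ^+ p - x | x : F].
Proof.
move=> cp; have ND (x : F) : (- x) ^+ p = - x ^+ p.
  by rewrite -[- x]add0r exprBp_pchar // expr0n gtn_eqF ?sub0r ?prime_gt0 ?(pcharf_prime cp).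
split=> [[x]|/imsetP[x _ ->]].
  rewrite frob_mapE mul1r => /(canRL (addKr _)) ->.
  by apply/imsetP; exists (- x) => //; rewrite ND opprK.
by exists (- x); rewrite frob_mapE mul1r ND addKr.
Qed.

(** * Reduction to representatives and their separation *)

Lemma dyn_equiv_no_fixed_point (F : finFieldType) (p k : nat) (a b b0 : F) :
    prime p -> #|F| = (p ^ k)%N -> b0 \notin [set x ^+ p - x | x : F] ->
    ~ (exists x, frob_map p a b x = x) ->
  dyn_equiv (frob_map p a b) (frob_map p 1 b0).
Proof.
move=> p_pr cF b0I nofix; have cp := card_finPcharP cF p_pr.
have p0 := prime_gt0 p_pr.
have [z z0 az] : exists2 z, z != 0 & a * z ^+ p.-1 = 1.
  (* If [h] is injective it is onto, and a preimage of b is a fixed point; otherwise a collision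
     gives z = x - y with a z^p = z. *)
  pose h x := x - a * x ^+ p.
  have [/injectiveP h_inj|/injectivePn[x [y xy hxy]]] := boolP (injectiveb h).
    case: nofix; exists (invF h_inj b); rewrite frob_mapE.
    by rewrite -[X in _ + X = _](f_invF h_inj) /h addrC subrK.
  have z0 : x - y != 0 by rewrite subr_eq0.
  exists (x - y) => //; apply: (mulIf z0).
  rewrite -mulrA -exprSr prednK // exprBp_pchar // mul1r.
  have -> : x - y = h x - h y + a * (x ^+ p - y ^+ p) by rewrite /h; ring.
  by rewrite hxy subrr add0r.
have f1 : dyn_equiv (frob_map p a b) (frob_map p 1 (b / z)).
  apply: dyn_equiv_sym; have := dyn_equiv_frob_scale a (b / z) p0 z0.
  by rewrite az [z * _]mulrC divfK.
apply: (dyn_equiv_trans f1).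
have [c [y [cK bE]]] := artin_schreier_decomp (b / z) p_pr cF b0I.
(* With c = 0, b/z would lie in the image of X^p - X, giving a fixed point. *)
have c0 : c != 0.
  apply/eqP=> c0; apply: nofix; apply: dyn_equiv_fixed_point (dyn_equiv_sym f1) _.
  apply/(artin_schreier_fixed_point _ cp)/imsetP; exists y => //.
  by rewrite bE c0 mul0r addr0.
(* As c lies in the prime field, scaling by c preserves the leading coefficient 1. *)
have c1 : c ^+ p.-1 = 1 by apply: (mulIf c0); rewrite -exprSr prednK // mul1r.
have := dyn_equiv_frob_scale 1 b0 p0 c0; rewrite c1 mulr1 => e.
apply: dyn_equiv_trans (dyn_equiv_sym e).
have := dyn_equiv_frob_translate 1 (c * b0) y cp.
by rewrite mul1r bE addrAC.
Qed.

Lemma dyn_equiv_fixed_linear (F : finFieldType) (p : nat) (a b : F) :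
  p \in [pchar F] -> (exists x, frob_map p a b x = x) ->
  dyn_equiv (frob_map p a b) (frob_map p a 0).
Proof.
move=> cp [x]; rewrite frob_mapE => fx.
have := dyn_equiv_frob_translate a b x cp.
by rewrite fx subrr => /dyn_equiv_sym.
Qed.

(** With a = g^i and d = gcd(i, p-1), adding t(p-1)/d to i/d gives, for a suitable t, an exponent m
    prime to q-1. Then dm = i + (p-1)t, so (g^d)^m differs from a by a (p-1)-th power, removed by
    scaling. *)
Lemma dyn_equiv_linear_divisor (F : finFieldType) (p k : nat) (g a : F) :
    prime p -> #|F| = (p ^ k)%N -> (#|F|.-1).-primitive_root g -> a != 0 ->
  exists2 d, (d %| p.-1)%N & dyn_equiv (frob_map p a 0) (frob_map p (g ^+ d) 0).
Proof.
move=> p_pr cF gP a0; have p0 := prime_gt0 p_pr; have p1 := prime_gt1 p_pr.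
have q0 := prim_order_gt0 gP.
have g0 : g != 0 := prim_root_neq0 gP.
(* Adding the order of g makes i positive, so that [coprime_shift] applies to i/d. *)
have [i i0 ai] : exists2 i, (0 < i)%N & a = g ^+ i.
  have [i ai] := prim_root_log gP a0.
  exists (i + #|F|.-1)%N; first by rewrite addn_gt0 q0 orbT.
  by rewrite exprD (prim_expr_order gP) mulr1.
pose d := gcdn i p.-1; have d0 : (0 < d)%N by rewrite gcdn_gt0 i0.
have di : (i %/ d * d = i)%N by rewrite divnK ?dvdn_gcdl.
have dp : (p.-1 %/ d * d = p.-1)%N by rewrite divnK ?dvdn_gcdr.
have cid : coprime (i %/ d) (p.-1 %/ d).
  by rewrite /coprime -(eqn_pmul2r d0) muln_gcdl di dp mul1n.
have id0 : (0 < i %/ d)%N by rewrite divn_gt0 // dvdn_leq // dvdn_gcdl.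
have [t ct] := coprime_shift q0 id0 cid.
exists d; first exact: dvdn_gcdr.
set m := (_ + _)%N in ct; have m0 : (0 < m)%N by rewrite addn_gt0 id0.
apply: dyn_equiv_trans (dyn_equiv_sym (dyn_equiv_frob_power (g ^+ d) m0 p0 ct)).
have -> : (g ^+ d) ^+ m = a * (g ^+ t) ^+ p.-1.
  rewrite ai -!exprM -exprD mulnDr mulnC di; congr (_ ^+ (_ + _)).
  by rewrite mulnA [(d * _)%N]mulnC dp mulnC.
have := dyn_equiv_frob_scale a 0 p0 (expf_neq0 t g0).
by rewrite mulr0 => /dyn_equiv_sym.
Qed.

(** For m = (p-1)/d the mk-th iterate of the first map is the identity, hence so is that of the
    second; the norm of g^e then has m-th power 1, so p-1 divides em. *)
Lemma dyn_equiv_linear_dvd (F : finFieldType) (p k d e : nat) (g : F) :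
    #|F| = (p ^ k)%N -> (#|F|.-1).-primitive_root g ->
    (0 < p.-1)%N -> (d %| p.-1)%N ->
  dyn_equiv (frob_map p (g ^+ d) 0) (frob_map p (g ^+ e) 0) -> (d %| e)%N.
Proof.
move=> cF gP p1 dp fe; pose m := (p.-1 %/ d)%N.
have d0 : (0 < d)%N := dvdn_gt0 p1 dp.
have m0 : (0 < m)%N by rewrite divn_gt0 // dvdn_leq.
have: norm_Fp p k (g ^+ d) ^+ m == 1.
  by rewrite (prim_root_norm_pow _ _ cF gP) mulnC divnK.
move=> /eqP Nd; have id1 x : iter (m * k) (frob_map p (g ^+ d) 0) x = x.
  by rewrite (iter_frob_map0_norm _ _ _ cF) Nd mul1r.
have := dyn_equiv_iter_id fe id1 1.
rewrite (iter_frob_map0_norm _ _ _ cF) mulr1 => /eqP.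
by rewrite (prim_root_norm_pow _ _ cF gP) -{1}(divnK dp) mulnC dvdn_pmul2r.
Qed.

Theorem theorem3p7 (p k : nat) (F : finFieldType)
    (p_prime : prime p) (k_ge1 : (1 <= k)%N) (cardF : #|F| = (p ^ k)%N) :
  [/\ #|frob_classes F p| = (tau (p - 1) + 1)%N,
      (exists! C : {set {ffun F -> F}},
         C \in frob_classes F p /\
         forall f : {ffun F -> F}, f \in C -> fixed_points f = set0)
    & forall a b : F, a != 0 ->
        (exists x : F, frob_map p a b x = x) ->
        (norm_Fp p k a = 1 -> #|fixed_points (frob_map p a b)| = p) /\
        (norm_Fp p k a <> 1 -> #|fixed_points (frob_map p a b)| = 1%N)].
Proof.
have cp := card_finPcharP cardF p_prime.
have p1 : (0 < p.-1)%N by rewrite -ltnS prednK ?prime_gt1 ?prime_gt0.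
have [g gP] := finField_prim_root F.
have [b0 b0I] := artin_schreier_not_surjective p_prime cardF.
have g0 := prim_root_neq0 gP.
pose f0 := frob_map p 1 b0; pose lin d := frob_map p (g ^+ d) 0.
have fix0P (f : {ffun F -> F}) : fixed_points f = set0 <-> ~ exists x, f x = x.
  split=> [fx [x fxx]|nofix]; last first.
    by apply/setP=> x; rewrite !inE; apply/eqP=> fx; apply: nofix; exists x.
  by have := in_set0 x; rewrite -fx inE fxx eqxx.
have f0_fix : ~ exists x, f0 x = x.
  by move/(artin_schreier_fixed_point _ cp) => H; rewrite H in b0I.
have lin_fix d : exists x, lin d x = x.
  by exists 0; rewrite frob_mapE expr0n gtn_eqF ?prime_gt0 // mulr0 addr0.
have sysP (f : {ffun F -> F}) : f \in frob_systems F p ->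
    exists a b, a != 0 /\ f = frob_map p a b.
  by case/imsetP=> -[a b] /=; rewrite inE /= => a0 ->; exists a, b.
have mem_sys (a b : F) : a != 0 -> frob_map p a b \in frob_systems F p.
  by move=> a0; apply/imsetP; exists (a, b); rewrite ?inE.
have f0_equiv (f : {ffun F -> F}) : f \in frob_systems F p ->
    ~ (exists x, f x = x) -> dyn_equiv f f0.
  move=> /sysP[a [b [a0 ->]]]; exact: (dyn_equiv_no_fixed_point p_prime cardF).
have eqR := @dyn_equivb_equivalence F.
have lin_inj (d e : nat) : (d %| p.-1)%N -> (e %| p.-1)%N ->
    dyn_equiv (lin d) (lin e) -> d = e.
  move=> dp ep de; apply/eqP; rewrite eqn_dvd; apply/andP; split.
    exact: (dyn_equiv_linear_dvd cardF gP p1 dp de).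
  exact: (dyn_equiv_linear_dvd cardF gP p1 ep (dyn_equiv_sym de)).
have mem_div d : (d \in divisors p.-1) = (d %| p.-1)%N by rewrite -dvdn_divisors.
split.
(* The class of [f0] accounts for the added 1, and the divisors of p-1 for the rest. *)
- pose rs := f0 :: [seq lin d | d <- divisors p.-1].
  have -> : (tau (p - 1) + 1)%N = size rs by rewrite /= size_map subn1 addn1.
  apply: card_equivalence_partition => //.
  + rewrite /= map_inj_in_uniq ?divisors_uniq ?andbT.
      apply/negP=> /mapP[d _ e]; apply: f0_fix; rewrite e; exact: lin_fix.
    move=> d e; rewrite !mem_div => dp ep de; apply: lin_inj => //.
    by rewrite de; apply: dyn_equiv_refl.
  + move=> f; rewrite inE => /predU1P[->|/mapP[d _ ->]].
      by apply: mem_sys; apply: oner_neq0.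
    by apply: mem_sys; apply: expf_neq0.
  + move=> f h; rewrite !inE => /predU1P[->|/mapP[d dp ->]].
      move=> /predU1P[->//|/mapP[d _ ->]] /dyn_equivP/dyn_equiv_sym e.
      by case: f0_fix; apply: dyn_equiv_fixed_point e (lin_fix d).
    move=> /predU1P[->|/mapP[e ep ->]] /dyn_equivP de.
      by case: f0_fix; apply: dyn_equiv_fixed_point de (lin_fix d).
    by congr lin; apply: lin_inj; rewrite -?mem_div.
  + move=> f fS; have [nofix|] := eqVneq (fixed_points f) set0.
      exists f0; first exact: mem_head.
      by apply/dyn_equivP/f0_equiv => //; apply/fix0P.
    case/set0Pn=> x; rewrite inE => /eqP fx.
    have [a [b [a0 fE]]] := sysP f fS.
    have [d dp da] := dyn_equiv_linear_divisor p_prime cardF gP a0.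
    exists (lin d); first by rewrite inE map_f ?orbT ?mem_div.
    apply/dyn_equivP; apply: dyn_equiv_trans da; rewrite fE.
    by apply: dyn_equiv_fixed_linear => //; exists x; rewrite -fE.
- have f0S : f0 \in frob_systems F p by apply: mem_sys; apply: oner_neq0.
  exists [set f in frob_systems F p | dyn_equivb f0 f]; split.
    split; first by apply/imsetP; exists f0.
    move=> f; rewrite inE => /andP[_ /dyn_equivP/dyn_equiv_sym e].
    by apply/fix0P=> fx; apply: f0_fix; apply: dyn_equiv_fixed_point e fx.
  move=> C [/imsetP[h hS ->]] Cfix.
  (* The representative h lies in its own class C, so it has no fixed point and is equivalent to
     [f0]. *)
  have : dyn_equivb h f0.
    apply/dyn_equivP/f0_equiv => //; apply/fix0P/Cfix.
    by rewrite inE hS; apply/dyn_equivP/dyn_equiv_refl.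
  move=> hf0; apply/setP=> f; rewrite !inE; congr (_ && _).
  by case: (eqR h f0 f) => _ ->.
- move=> a b a0 fx; split; first exact: (card_fixed_norm1 p_prime cardF a0 fx).
  exact: (card_fixed_norm_neq1 p_prime cardF fx).
Qed.
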